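(* Let $s\ge 1$ and $k\ge 1$ be integers and write $k=k'+sk''$ with $1\le k'\le s$ and $k''\ge 0$. Then the generating function $A(x)=\sum_{n\ge 0}a_n(q)x^n$ for the distribution of the number of occurrences of the string $a(a+s)$ on the set of $k$-ary words of length $n$, $n\ge 0$, is given by $$A(x)=\frac{(1+(1-q)x)^2}{1-(k-2+2q)x-(k+s-1+q)(1-q)x^2+\bigl(k'(1+(1-q)x)-s\bigr)x\,((q-1)x)^{k''+1}}.$$
   Context: A $k$-ary word of length $n$ is a sequence $\rho=\rho_1\cdots\rho_n\in[k]^n$, where $[k]=\{1,\dots,k\}$. An occurrence of the string $a(a+s)$ in $\rho$ is an index $i\in\{1,\dots,n-1\}$ with $\rho_{i+1}-\rho_i=s$; let $\mu(\rho)$ be the number of such indices. With $q$ an indeterminate, $a_n(q)=\sum_{\rho\in[k]^n}q^{\mu(\rho)}$ for $n\ge 1$, and $a_0(q)=1$. The identity is one of formal power series in $x$. *)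

(* Defs.v *)
From mathcomp Require Import all_boot all_order all_algebra.

Set Implicit Arguments.
Unset Strict Implicit.
Unset Printing Implicit Defensive.

Import GRing.Theory.

Local Open Scope ring_scope.

(* A formal power series is its coefficient sequence. *)
Definition fps (R : Type) := nat -> R.

Section FormalPowerSeries.
Variable R : comUnitRingType.
Implicit Types (p : {poly R}) (u v : fps R).

Definition fps_of_poly p : fps R := fun n => p`_n.

Definition fps_mul u v : fps R :=
  fun n => \sum_(i < n.+1) u i * v (n - i)%N.

(* The first n coefficients of 1 / u, for u with invertible constant term. *)
Fixpoint fps_inv_seq u n : seq R :=
  if n is m.+1 then
    let s := fps_inv_seq u m in
    rcons s ((u 0%N)^-1 *
             ((m == 0%N)%:R - \sum_(i < m) u i.+1 * s`_(m - i.+1)))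
  else [::].

Definition fps_inv u : fps R := fun n => (fps_inv_seq u n.+1)`_n.

Definition fps_div u v : fps R := fps_mul u (fps_inv v).

Lemma size_fps_inv_seq u n : size (fps_inv_seq u n) = n.
Proof. by elim: n => //= n IHn; rewrite size_rcons IHn. Qed.

Lemma nth_fps_inv_seq u n i : (i < n)%N -> (fps_inv_seq u n)`_i = fps_inv u i.
Proof.
elim: n => // n IHn; rewrite ltnS leq_eqVlt => /predU1P[-> //|lt_in].
by rewrite /= nth_rcons size_fps_inv_seq lt_in IHn.
Qed.

Lemma fps_invE u n :
  fps_inv u n = (u 0%N)^-1 *
    ((n == 0%N)%:R - \sum_(i < n) u i.+1 * fps_inv u (n - i.+1)%N).
Proof.
rewrite {1}/fps_inv /= nth_rcons size_fps_inv_seq ltnn eqxx.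
congr (_ * (_ - _)); apply: eq_bigr => i _.
by rewrite nth_fps_inv_seq // ltn_subrL /=; case: n i => // -[].
Qed.

Lemma fps_mulV u : u 0%N \is a GRing.unit ->
  fps_mul u (fps_inv u) =1 fps_of_poly 1.
Proof.
move=> u0U n; rewrite /fps_mul /fps_of_poly big_ord_recl subn0 fps_invE.
rewrite mulVKr // coef1.
by under [X in _ + X]eq_bigr => i _ do rewrite /bump /=; rewrite subrK.
Qed.

End FormalPowerSeries.

Section Words.
Variables (s k : nat).

(* The alphabet {1, ..., k} is encoded as 'I_k, the ordinal j standing for the
   letter j + 1, and positions are likewise counted from 0; neither shift
   changes the number of occurrences. *)
Definition word n := n.-tuple 'I_k.

Definition occurrence n (w : word n) (i : 'I_n) : bool :=
  [exists j : 'I_n, (j == i.+1 :> nat) &&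
     ((tnth w j)%:Z - (tnth w i)%:Z == s%:Z)].

Definition mu n (w : word n) : nat := #|[set i | occurrence w i]|.

(* The indeterminate q is 'X : {poly int}. *)
Definition distribution n : {poly int} := \sum_(w : word n) 'X^(mu w).

Lemma distribution0 : distribution 0 = 1.
Proof.
rewrite /distribution (big_pred1 [tuple]) => [|w]; last first.
  by apply/esym/eqP; exact: tuple0.
by rewrite /mu (_ : [set _ | _] = set0) ?cards0 //; apply/setP => -[].
Qed.

Definition generating_function : fps {poly int} := distribution.

End Words.

(* Main.v *)
Require Import Defs.
From mathcomp Require Import all_boot all_order all_algebra.
From mathcomp Require Import zify ring.

Import GRing.Theory.

Local Open Scope ring_scope.

(** The proof reads the inverse of A(x) off a recurrence for a_n(q).  Write
    a_n for [distribution s k n] and f_n(j) for the part of a_{n+1} carried by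
    the words whose first letter is j.  Deleting the first letter j of a word
    loses an occurrence exactly when the next letter is j + s, so that
      f_n(j) = a_n + (q - 1) f_{n-1}(j + s)    for n >= 1,
    with f_0 = 1, and f_{n-1}(j + s) read as 0 when j + s is not a letter
    ([starting_withS]).  Unrolling it along j, j + s, j + 2s, ... and summing
    over j gives [distribution_rec]:
      a_{n+1} = sum_(i <= n) (k - i s)^+ (q - 1)^i a_{n-i},
    the number (k - i s)^+ being the number of letters j with j + i s still a
    letter.  In terms of series, A(x) (1 - x S) = 1, where S is the sum of
    (k - i s) t^i over the i such that k - i s > 0, with t = (q - 1) x.

    As k = k' + s k'' with 1 <= k' <= s, those are the i <= k'', and S is a
    finite arithmetico-geometric sum, which (1 - t)^2 clears
    ([sum_arith_geom]).  Expanding (1 - t)^2 (1 - x S) gives the denominator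
    of the formula, and (1 - t)^2 is its numerator. *)

(** * Products and quotients of power series *)

Section PowerSeriesProduct.
Set Implicit Arguments.
Unset Strict Implicit.
Variable R : comUnitRingType.
Implicit Types (u v w : fps R) (p r : {poly R}).

Lemma eq_fps_mul u u' v v' n :
    (forall i, (i <= n)%N -> u i = u' i) ->
    (forall i, (i <= n)%N -> v i = v' i) ->
  fps_mul u v n = fps_mul u' v' n.
Proof.
move=> eq_u eq_v; apply: eq_bigr => i _.
by rewrite eq_u ?eq_v ?leq_subr // -ltnS.
Qed.

(** A coefficient of a product only involves finitely many coefficients of the
    factors, so the ring laws of series follow from those of polynomials. *)
Definition truncation n u : {poly R} := \poly_(i < n.+1) u i.

Lemma coef_truncation n u i : (i <= n)%N -> (truncation n u)`_i = u i.
Proof. by move=> le_in; rewrite coef_poly ltnS le_in. Qed.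

Lemma fps_mul_truncation n u v i : (i <= n)%N ->
  fps_mul u v i = (truncation n u * truncation n v)`_i.
Proof.
move=> le_in; rewrite coefM; apply: eq_fps_mul => j le_ji;
  by rewrite coef_truncation // (leq_trans le_ji).
Qed.

Lemma fps_of_polyM p r :
  fps_of_poly (p * r) =1 fps_mul (fps_of_poly p) (fps_of_poly r).
Proof. by move=> n; rewrite /fps_of_poly coefM. Qed.

Lemma fps_mulC u v : fps_mul u v =1 fps_mul v u.
Proof. by move=> n; rewrite !(fps_mul_truncation _ _ (leqnn n)) mulrC. Qed.

Lemma fps_mulA u v w :
  fps_mul u (fps_mul v w) =1 fps_mul (fps_mul u v) w.
Proof.
move=> n; set T := truncation n.
transitivity ((T u * (T v * T w))`_n); last rewrite mulrA; rewrite coefM.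
  by apply: eq_fps_mul => i le_in;
    rewrite ?coef_truncation // (@fps_mul_truncation n).
by apply: esym; apply: eq_fps_mul => i le_in;
    rewrite ?coef_truncation // (@fps_mul_truncation n).
Qed.

Lemma fps_mul1 u : fps_mul u (fps_of_poly 1) =1 u.
Proof.
move=> n; rewrite fps_mulC /fps_mul big_ord_recl subn0 /fps_of_poly coef1 mul1r.
by rewrite big1 ?addr0 // => i _; rewrite coef1 mul0r.
Qed.

Lemma fps_divP (N D : fps R) u : D 0%N \is a GRing.unit ->
  fps_mul D u =1 N -> u =1 fps_div N D.
Proof.
move=> D0U DuN n; rewrite -[LHS]fps_mul1.
rewrite -(@eq_fps_mul u u _ _ n _ (fun i _ => fps_mulV D0U i)) //.
by rewrite fps_mulA; apply: eq_fps_mul => // i _; rewrite fps_mulC DuN.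
Qed.

End PowerSeriesProduct.

(** * A recurrence for the distribution *)

Section WordRecurrence.
Set Implicit Arguments.
Unset Strict Implicit.
Variables s k : nat.

Lemma big_tuple_cons (V : nmodType) n (F : word k n.+1 -> V) :
  \sum_(w : word k n.+1) F w =
    \sum_(j < k) \sum_(w : word k n) F [tuple of j :: w].
Proof.
rewrite pair_big /=.
rewrite (reindex (fun p : 'I_k * word k n => [tuple of p.1 :: p.2])) //=.
exists (fun w : word k n.+1 => (thead w, [tuple of behead w]))
  => [[j w] _|w _] /=.
  by congr (_, _); apply: val_inj.
by rewrite -tuple_eta.
Qed.

(** An occurrence in j :: w is either at the first position, where it only
    depends on j and the head of w, or a shifted occurrence in w. *)
Lemma mu_cons n (j : 'I_k) (w : word k n) :
  mu s [tuple of j :: w] =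
    ((if val w is l :: _ then l == (j + s)%N :> nat else false) + mu s w)%N.
Proof.
rewrite /mu -!sum1_card big_mkcond [in RHS]big_mkcond big_ord_recl.
congr (_ + _)%N.
  rewrite inE.
  have -> : occurrence s [tuple of j :: w] ord0 =
            (if val w is l :: _ then l == (j + s)%N :> nat else false).
    case: n w => [w|n w].
      rewrite tuple0 /=; apply/existsP => -[i /andP[/eqP i1 _]].
      by have := ltn_ord i; rewrite i1.
    case/tupleP: w => l w /=; apply/existsP/eqP => [[i /andP[/eqP i1]]|ljs].
      by rewrite (_ : i = lift ord0 ord0) ?tnthS ?tnth0 /=;
        [lia | exact: val_inj].
    by exists (lift ord0 ord0); rewrite tnthS !tnth0 /=; lia.
  by case: (val w) => [|l r] //; case: eqP.
apply: eq_bigr => i _; rewrite !inE.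
suff -> : occurrence s [tuple of j :: w] (lift ord0 i) = occurrence s w i by [].
apply/existsP/existsP => [[m]|[m /andP[/eqP mi ms]]].
  case: (unliftP ord0 m) => [m' ->|-> //].
  by rewrite !tnthS => /andP[/eqP[mi] ms]; exists m';
    rewrite ms andbT; apply/eqP.
by exists (lift ord0 m); rewrite !tnthS ms andbT /= /bump mi.
Qed.

Definition starting_with n (j : 'I_k) : {poly int} :=
  \sum_(w : word k n) 'X^(mu s [tuple of j :: w]).

Lemma distributionS n :
  distribution s k n.+1 = \sum_(j < k) starting_with n j.
Proof. exact: big_tuple_cons. Qed.

Lemma starting_with0 j : starting_with 0 j = 1.
Proof.
rewrite -(distribution0 s k); apply: eq_bigr => w _.
by rewrite mu_cons tuple0.
Qed.

(** If the next letter l is j + s, the weight q of the occurrence that the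
    first letter j creates is split as 1 + (q - 1); the summands 1 then
    rebuild the whole distribution of the tail. *)
Lemma starting_withS n j :
  starting_with n.+1 j = distribution s k n.+1 +
    ('X - 1) * \sum_(l < k | l == (j + s)%N :> nat) starting_with n l.
Proof.
rewrite distributionS /starting_with big_tuple_cons mulr_sumr.
rewrite [X in _ + X]big_mkcond -big_split /=; apply: eq_bigr => l _.
under eq_bigr => w _ do rewrite mu_cons /= exprD.
rewrite -mulr_sumr; case: eqP => _; last by rewrite expr0 mul1r addr0.
by rewrite expr1; ring.
Qed.

(** The recurrence [starting_withS] unrolled along the chain j, j + s,
    j + 2s, ... of letters, until it leaves the alphabet or the word ends. *)
Lemma starting_withE n j :
  starting_with n j = \sum_(i < n.+1 | (j + i * s < k)%N)
    ('X - 1) ^+ i * distribution s k (n - i).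
Proof.
elim: n j => [|n IHn] j.
  rewrite starting_with0 big_mkcond big_ord1 mul0n addn0 ltn_ord expr0 mul1r.
  by rewrite distribution0.
rewrite starting_withS [RHS]big_mkcond big_ord_recl mul0n addn0 ltn_ord.
rewrite expr0 mul1r subn0; congr (_ + _).
under eq_bigr => l _ do rewrite IHn.
case: (ltnP (j + s) k) => [ljs|kjs].
  rewrite (big_pred1 (Ordinal ljs)) //= big_mkcond mulr_sumr.
  apply: eq_bigr => i _; rewrite /bump /= mulSn addnA add1n subSS.
  by case: ifP; rewrite ?mulr0 // exprS mulrA.
rewrite big_pred0 ?mulr0 => [|l]; last by have := ltn_ord l; lia.
rewrite [RHS]big1 // => i _; rewrite /= mulSn addnA ifF //.
by rewrite ltnNge (leq_trans kjs) // leq_addr.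
Qed.

Lemma card_ord_shift m : #|[pred j : 'I_k | (j + m < k)%N]| = (k - m)%N.
Proof.
rewrite -sum1_card (eq_bigl (fun j : 'I_k => (j < k - m)%N)); last first.
  by move=> j; rewrite inE ltn_subRL addnC.
by rewrite (big_ord_narrow (leq_subr m k)) sum1_card card_ord.
Qed.

Lemma distribution_rec n :
  distribution s k n.+1 = \sum_(i < n.+1)
    (k - i * s)%:R * ('X - 1) ^+ i * distribution s k (n - i).
Proof.
rewrite distributionS; under eq_bigr => j _ do rewrite starting_withE.
rewrite (exchange_big_dep xpredT) //=; apply: eq_bigr => i _.
by rewrite sumr_const card_ord_shift -mulrA mulr_natl.
Qed.

(** As a polynomial in x, this is the cluster sum of Goulden and Jackson with
    one factor x removed: the coefficient of x^i counts the chains j, j + s,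
    ..., j + i s in the alphabet, each of its i marked occurrences being
    weighted by q - 1. *)
Definition cluster_poly m : {poly {poly int}} :=
  \poly_(i < m.+1) ((k - i * s)%:R * ('X - 1) ^+ i).

(** The bound on m ensures that cutting the cluster sum at degree m only
    drops terms whose count k - i s, a truncated difference, is 0. *)
Lemma cluster_poly_distribution m : (k <= m.+1 * s)%N ->
  fps_mul (fps_of_poly (1 - 'X * cluster_poly m)) (distribution s k) =1
  fps_of_poly 1.
Proof.
move=> le_k [|n]; rewrite /fps_mul /fps_of_poly !coef1.
  by rewrite big_ord1 coefB coef1 coefXM subr0 mul1r distribution0.
rewrite big_ord_recl coefB coef1 coefXM subr0 mul1r subn0 distribution_rec.
rewrite -big_split big1 // => i _ /=.
rewrite coefB coef1 coefXM sub0r coef_poly subSS ltnS.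
case: leqP => [_|lt_mi]; first by rewrite mulNr subrr.
rewrite (_ : (k - i * s)%N = 0%N) ?mul0r ?mulr0n ?oppr0 ?mul0r ?addr0 //.
by apply/eqP; rewrite subn_eq0 (leq_trans le_k) // leq_mul2r lt_mi orbT.
Qed.

End WordRecurrence.

(** * The closed form *)

(** The sum S_m on the left satisfies S_{m+1} = k' + s (m + 1) + t S_m, which
    yields the closed form by induction on m. *)
Lemma sum_arith_geom (R : comNzRingType) (k' s m : nat) (t : R) :
  (1 - t) ^+ 2 * \sum_(i < m.+1) (k' + s * (m - i))%:R * t ^+ i =
  (k' + s * m)%:R - (k' + s * m + s)%:R * t
    - (k'%:R * (1 - t) - s%:R) * t ^+ m.+1.
Proof.
elim: m => [|m IHm].
  by rewrite big_ord1 /= subn0 muln0 addn0 natrD; ring.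
rewrite big_ord_recl; under eq_bigr => i _ do rewrite lift0 subSS exprS mulrCA.
rewrite -mulr_sumr mulrDr [_ * (t * _)]mulrCA IHm subn0.
by rewrite !natrD !natrM !exprS -[m.+1]addn1 natrD; ring.
Qed.

Theorem theorem2p3 (s k k' k'' : nat) (hs : (1 <= s)%N) (hk : (1 <= k)%N)
    (hk_eq : k = (k' + s * k'')%N) (hk' : (1 <= k' <= s)%N) :
  let q : {poly {poly int}} := ('X : {poly int})%:P in
  let x : {poly {poly int}} := 'X in
  generating_function s k =1
    fps_div
      (fps_of_poly ((1 + (1 - q) * x) ^+ 2))
      (fps_of_poly
         (1 - (k%:R - 2 + 2 * q) * x
            - (k%:R + s%:R - 1 + q) * (1 - q) * x ^+ 2
            + (k'%:R * (1 + (1 - q) * x) - s%:R) * x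
              * ((q - 1) * x) ^+ k''.+1)).
Proof.
move=> q x; set N := _ ^+ 2; set D := (X in fps_div _ (fps_of_poly X)).
have clusterE : cluster_poly s k k'' =
    \sum_(i < k''.+1) (k' + s * (k'' - i))%:R * ((q - 1) * x) ^+ i.
  rewrite /cluster_poly poly_def; apply: eq_bigr => i _.
  rewrite -mul_polyC rmorphM rmorph_nat rmorphXn rmorphB rmorph1 exprMn mulrA.
  congr (_%:R * _ * _); rewrite hk_eq [(i * s)%N]mulnC -addnBA ?mulnBr //.
  by rewrite leq_mul2l -[(i <= _)%N]ltnS ltn_ord orbT.
have DE : D = N * (1 - 'X * cluster_poly s k k'').
  have -> : N = (1 - (q - 1) * x) ^+ 2 by rewrite /N; ring.
  rewrite mulrBr mulrCA clusterE sum_arith_geom -hk_eq natrD.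
  by rewrite /D -/x; ring.
(* Both factors of D have constant term 1, being 1 plus multiples of x. *)
have D0 : fps_of_poly D 0 = 1.
  rewrite DE /fps_of_poly coefM big_ord1 coefB coefXM subr0 coef1 mulr1.
  by rewrite -horner_coef0 /N /x !hornerE expr1n.
apply: fps_divP => [|n]; first by rewrite D0 unitr1.
rewrite DE; set P := 1 - _.
transitivity (fps_mul (fps_mul (fps_of_poly N) (fps_of_poly P))
                      (generating_function s k) n).
  by apply: eq_fps_mul => // i _; rewrite fps_of_polyM.
(* The factor P is the inverse of the generating function. *)
rewrite -fps_mulA -[RHS]fps_mul1; apply: eq_fps_mul => // i _.
apply: cluster_poly_distribution.
by case/andP: hk' => _; rewrite hk_eq mulSn mulnC leq_add2r.
Qed.
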